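(* Let $K$ be an ap-bi-Kleene algebra (defined in the context), with $d(x)=a(a(x))$, $\langle x\rangle y=d(x\cdot y)$ and $[x]y=a(x\cdot a(y))$. Then for all $x,y\in K$ and all $p,q\in d(K)=\{d(z)\mid z\in K\}$: (1) $\langle x+y\rangle p=\langle x\rangle p+\langle y\rangle p$, $\langle x\cdot y\rangle p=\langle x\rangle\langle y\rangle p$, $\langle p\rangle q=p\cdot q$, $\langle x\|y\rangle p=\langle x\rangle p\cdot\langle y\rangle p$, $p+\langle x\rangle\langle x^\ast\rangle p=\langle x^\ast\rangle p$, and $\langle x\rangle p\le p\Rightarrow\langle x^\ast\rangle p\le p$; (2) $[x+y]p=[x]p\cdot[y]p$, $[x\cdot y]p=[x][y]p$, $[p]q=a(p)+q$, $[x\|y]p=[x]p+[y]p$, $p\cdot[x][x^\ast]p=[x^\ast]p$, and $p\le[x]p\Rightarrow p\le[x^\ast]p$.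
   Context: A proto-dioid is a structure $(S,+,\cdot,0,1_\sigma)$ such that $+$ is associative, commutative and idempotent with unit $0$ (ordered by $x\le y\iff x+y=y$), and $1_\sigma\cdot x=x$, $x\cdot 1_\sigma=x$, $x\cdot y+x\cdot z\le x\cdot(y+z)$, $(x+y)\cdot z=x\cdot z+y\cdot z$, $0\cdot x=0$ (multiplication need not be associative). A proto-trioid $(S,+,\cdot,\|,0,1_\sigma,1_\pi)$ is a proto-dioid such that $\|$ is associative and commutative with unit $1_\pi$, $x\|(y+z)=x\|y+x\|z$ and $x\|0=0$. An ap-dioid is a proto-dioid with a unary operation $a$ such that $x\cdot(y\cdot z)=(x\cdot y)\cdot z$ whenever one of $x,y,z$ equals $a(w)$ for some $w$, and $a(x)\cdot x=0$, $a(x\cdot y)=a(x\cdot a(a(y)))$, $a(x)+a(a(x))=1_\sigma$, $a(x)\cdot(y+z)=a(x)\cdot y+a(x)\cdot z$. An ap-trioid is an ap-dioid which is also a proto-trioid and satisfies $(x\|y)\cdot a(z)=(x\cdot a(z))\|(y\cdot a(z))$, $a(x\|y)=a(x)+a(y)$, $a(x)\|a(y)=a(x)\cdot a(y)$. An ap-Kleene algebra is an ap-dioid with a unary operation $^\ast$ satisfying $1_\sigma+x\cdot x^\ast\le x^\ast$ and $a(z)+x\cdot y\le y\Rightarrow x^\ast\cdot a(z)\le y$. An ap-bi-Kleene algebra is an ap-Kleene algebra which is also an ap-trioid. *)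

(* Defs.v *)
Definition sum_le {S : Type} (add : S -> S -> S) (x y : S) : Prop :=
  add x y = y.

(* Multiplication is neither assumed associative nor left-distributive. *)
Record is_proto_dioid (S : Type) (add mul : S -> S -> S) (zero one_s : S)
    : Prop := {
  add_assoc : forall x y z, add x (add y z) = add (add x y) z;
  add_comm : forall x y, add x y = add y x;
  add_idem : forall x, add x x = x;
  add_zero : forall x, add x zero = x;
  mul_one_l : forall x, mul one_s x = x;
  mul_one_r : forall x, mul x one_s = x;
  mul_subdistr_l : forall x y z,
    sum_le add (add (mul x y) (mul x z)) (mul x (add y z));
  mul_distr_r : forall x y z, mul (add x y) z = add (mul x z) (mul y z);
  mul_zero_l : forall x, mul zero x = zero
}.

Record is_proto_trioid (S : Type) (add mul par : S -> S -> S)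
    (zero one_s one_p : S) : Prop := {
  proto_trioid_proto_dioid : is_proto_dioid S add mul zero one_s;
  par_assoc : forall x y z, par x (par y z) = par (par x y) z;
  par_comm : forall x y, par x y = par y x;
  par_one : forall x, par x one_p = x;
  par_distr_l : forall x y z, par x (add y z) = add (par x y) (par x z);
  par_zero : forall x, par x zero = zero
}.

Record is_ap_dioid (S : Type) (add mul : S -> S -> S) (zero one_s : S)
    (a : S -> S) : Prop := {
  ap_dioid_proto_dioid : is_proto_dioid S add mul zero one_s;
  mul_assoc_a : forall x y z,
    (exists w, x = a w \/ y = a w \/ z = a w) ->
    mul x (mul y z) = mul (mul x y) z;
  a_annihil : forall x, mul (a x) x = zero;
  a_local : forall x y, a (mul x y) = a (mul x (a (a y)));
  a_compl : forall x, add (a x) (a (a x)) = one_s;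
  a_distr_l : forall x y z,
    mul (a x) (add y z) = add (mul (a x) y) (mul (a x) z)
}.

Record is_ap_trioid (S : Type) (add mul par : S -> S -> S)
    (zero one_s one_p : S) (a : S -> S) : Prop := {
  ap_trioid_ap_dioid : is_ap_dioid S add mul zero one_s a;
  ap_trioid_proto_trioid : is_proto_trioid S add mul par zero one_s one_p;
  par_mul_a : forall x y z,
    mul (par x y) (a z) = par (mul x (a z)) (mul y (a z));
  a_par : forall x y, a (par x y) = add (a x) (a y);
  par_a_a : forall x y, par (a x) (a y) = mul (a x) (a y)
}.

Record is_ap_kleene (S : Type) (add mul : S -> S -> S) (zero one_s : S)
    (a star : S -> S) : Prop := {
  ap_kleene_ap_dioid : is_ap_dioid S add mul zero one_s a;
  star_unfold : forall x,
    sum_le add (add one_s (mul x (star x))) (star x);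
  star_induct : forall x y z,
    sum_le add (add (a z) (mul x y)) y ->
    sum_le add (mul (star x) (a z)) y
}.

Record ap_bi_kleene_algebra := {
  carrier :> Type;
  add : carrier -> carrier -> carrier;
  mul : carrier -> carrier -> carrier;
  par : carrier -> carrier -> carrier;
  zero : carrier;
  one_s : carrier;
  one_p : carrier;
  antidom : carrier -> carrier;
  star : carrier -> carrier;
  ap_bi_kleene_ap_kleene :
    is_ap_kleene carrier add mul zero one_s antidom star;
  ap_bi_kleene_ap_trioid :
    is_ap_trioid carrier add mul par zero one_s one_p antidom
}.

Arguments add {_} _ _.
Arguments mul {_} _ _.
Arguments par {_} _ _.
Arguments zero {_}.
Arguments one_s {_}.
Arguments one_p {_}.
Arguments antidom {_} _.
Arguments star {_} _.

Definition dom {K : ap_bi_kleene_algebra} (x : K) : K := antidom (antidom x).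

Definition dia {K : ap_bi_kleene_algebra} (x y : K) : K := dom (mul x y).

Definition box {K : ap_bi_kleene_algebra} (x y : K) : K :=
  antidom (mul x (antidom y)).

Definition in_dom {K : ap_bi_kleene_algebra} (p : K) : Prop :=
  exists z : K, p = dom z.

Declare Scope apbika_scope.
Delimit Scope apbika_scope with K.

Notation "x + y" := (add x y) : apbika_scope.
Notation "x ⋅ y" := (mul x y)
  (at level 40, left associativity) : apbika_scope.
Notation "x ∥ y" := (par x y)
  (at level 45, left associativity) : apbika_scope.
Notation "x ^∗" := (star x) (at level 1, format "x ^∗") : apbika_scope.
Notation "x <= y" := (sum_le add x y) : apbika_scope.
Notation "⟨ x ⟩ y" := (dia x y)
  (at level 30, x at level 200, y at level 30, right associativity,
   format "⟨ x ⟩  y") : apbika_scope.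
Notation "⟦ x ⟧ y" := (box x y)
  (at level 30, x at level 200, y at level 30, right associativity,
   format "⟦ x ⟧  y") : apbika_scope.

(* Main.v *)
(** The set of antidomain elements is closed under sums, because
    [a x + a y = a (x ∥ y)], and under products, where multiplication is the
    meet; the law [a (a x ⋅ a y) = d x + d y] then comes for free from
    [a x ∥ a y = a x ⋅ a y].  The diamond laws follow from locality and the
    associativity of multiplication around tests.  For diamond induction one
    applies star induction to [y = p ⋅ (x^∗ ⋅ p)], whose domain lies below
    [p]; the star unfold equation follows by applying diamond induction to
    [p + ⟨x⟩ ⟨x^∗⟩ p].  The box laws are the images of the diamond laws under
    the antidomain operation. *)

From Stdlib Require Import Setoid.
Require Import Defs.

Local Open Scope apbika_scope.

(** * Projections of the axioms *)

Lemma kleene_dioid (K : ap_bi_kleene_algebra) :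
  is_ap_dioid K add mul zero one_s antidom.
Proof. exact (ap_kleene_ap_dioid _ _ _ _ _ _ _ (ap_bi_kleene_ap_kleene K)). Qed.

Lemma kleene_proto_dioid (K : ap_bi_kleene_algebra) :
  is_proto_dioid K add mul zero one_s.
Proof. exact (ap_dioid_proto_dioid _ _ _ _ _ _ (kleene_dioid K)). Qed.

Lemma addA {K : ap_bi_kleene_algebra} (x y z : K) : x + (y + z) = x + y + z.
Proof. apply (add_assoc _ _ _ _ _ (kleene_proto_dioid K)). Qed.

Lemma addC {K : ap_bi_kleene_algebra} (x y : K) : x + y = y + x.
Proof. apply (add_comm _ _ _ _ _ (kleene_proto_dioid K)). Qed.

Lemma addxx {K : ap_bi_kleene_algebra} (x : K) : x + x = x.
Proof. apply (add_idem _ _ _ _ _ (kleene_proto_dioid K)). Qed.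

Lemma addx0 {K : ap_bi_kleene_algebra} (x : K) : x + zero = x.
Proof. apply (add_zero _ _ _ _ _ (kleene_proto_dioid K)). Qed.

Lemma mul1x {K : ap_bi_kleene_algebra} (x : K) : one_s ⋅ x = x.
Proof. apply (mul_one_l _ _ _ _ _ (kleene_proto_dioid K)). Qed.

Lemma mulx1 {K : ap_bi_kleene_algebra} (x : K) : x ⋅ one_s = x.
Proof. apply (mul_one_r _ _ _ _ _ (kleene_proto_dioid K)). Qed.

Lemma mulDx {K : ap_bi_kleene_algebra} (x y z : K) :
  (x + y) ⋅ z = x ⋅ z + y ⋅ z.
Proof. apply (mul_distr_r _ _ _ _ _ (kleene_proto_dioid K)). Qed.

Lemma mul0x {K : ap_bi_kleene_algebra} (x : K) : zero ⋅ x = zero.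
Proof. apply (mul_zero_l _ _ _ _ _ (kleene_proto_dioid K)). Qed.

Lemma mul_antidom_self {K : ap_bi_kleene_algebra} (x : K) :
  antidom x ⋅ x = zero.
Proof. apply (a_annihil _ _ _ _ _ _ (kleene_dioid K)). Qed.

Lemma antidom_mul_dom {K : ap_bi_kleene_algebra} (x y : K) :
  antidom (x ⋅ dom y) = antidom (x ⋅ y).
Proof. symmetry; apply (a_local _ _ _ _ _ _ (kleene_dioid K)). Qed.

Lemma add_antidom_dom {K : ap_bi_kleene_algebra} (x : K) :
  antidom x + dom x = one_s.
Proof. apply (a_compl _ _ _ _ _ _ (kleene_dioid K)). Qed.

Lemma mul_antidom_add {K : ap_bi_kleene_algebra} (x y z : K) :
  antidom x ⋅ (y + z) = antidom x ⋅ y + antidom x ⋅ z.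
Proof. apply (a_distr_l _ _ _ _ _ _ (kleene_dioid K)). Qed.

Lemma mulA_l {K : ap_bi_kleene_algebra} (w y z : K) :
  antidom w ⋅ (y ⋅ z) = antidom w ⋅ y ⋅ z.
Proof. apply (mul_assoc_a _ _ _ _ _ _ (kleene_dioid K)); eauto. Qed.

Lemma mulA_m {K : ap_bi_kleene_algebra} (x w z : K) :
  x ⋅ (antidom w ⋅ z) = x ⋅ antidom w ⋅ z.
Proof. apply (mul_assoc_a _ _ _ _ _ _ (kleene_dioid K)); eauto. Qed.

Lemma mulA_r {K : ap_bi_kleene_algebra} (x y w : K) :
  x ⋅ (y ⋅ antidom w) = x ⋅ y ⋅ antidom w.
Proof. apply (mul_assoc_a _ _ _ _ _ _ (kleene_dioid K)); eauto. Qed.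

Lemma mul_par_antidom {K : ap_bi_kleene_algebra} (x y z : K) :
  (x ∥ y) ⋅ antidom z = (x ⋅ antidom z) ∥ (y ⋅ antidom z).
Proof. apply (par_mul_a _ _ _ _ _ _ _ _ (ap_bi_kleene_ap_trioid K)). Qed.

Lemma antidom_par {K : ap_bi_kleene_algebra} (x y : K) :
  antidom (x ∥ y) = antidom x + antidom y.
Proof. apply (a_par _ _ _ _ _ _ _ _ (ap_bi_kleene_ap_trioid K)). Qed.

Lemma par_antidom {K : ap_bi_kleene_algebra} (x y : K) :
  antidom x ∥ antidom y = antidom x ⋅ antidom y.
Proof. apply (par_a_a _ _ _ _ _ _ _ _ (ap_bi_kleene_ap_trioid K)). Qed.

(** * Order *)

Lemma le_refl {K : ap_bi_kleene_algebra} (x : K) : x <= x.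
Proof. apply addxx. Qed.

Lemma le_trans {K : ap_bi_kleene_algebra} (x y z : K) :
  x <= y -> y <= z -> x <= z.
Proof. unfold sum_le; intros H1 H2; rewrite <- H2, addA, H1; reflexivity. Qed.

Lemma le_antisym {K : ap_bi_kleene_algebra} (x y : K) :
  x <= y -> y <= x -> x = y.
Proof. unfold sum_le; intros H1 H2; rewrite <- H1, addC, H2; reflexivity. Qed.

Lemma le_add_l {K : ap_bi_kleene_algebra} (x y : K) : x <= x + y.
Proof. unfold sum_le; rewrite addA, addxx; reflexivity. Qed.

Lemma le_add_r {K : ap_bi_kleene_algebra} (x y : K) : y <= x + y.
Proof. rewrite addC; apply le_add_l. Qed.

Lemma add_lub {K : ap_bi_kleene_algebra} (x y z : K) :
  x <= z -> y <= z -> x + y <= z.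
Proof. unfold sum_le; intros H1 H2; rewrite <- addA, H2; exact H1. Qed.

Lemma le_zero_eq {K : ap_bi_kleene_algebra} (x : K) : x <= zero -> x = zero.
Proof. unfold sum_le; rewrite addx0; auto. Qed.

Lemma mul_mono_l {K : ap_bi_kleene_algebra} (x y z : K) :
  x <= y -> x ⋅ z <= y ⋅ z.
Proof. unfold sum_le; intros H; rewrite <- mulDx, H; reflexivity. Qed.

Lemma mul_mono_r {K : ap_bi_kleene_algebra} (x y z : K) :
  y <= z -> x ⋅ y <= x ⋅ z.
Proof.
intros H; apply le_trans with (x ⋅ y + x ⋅ z); [apply le_add_l|].
pose proof (mul_subdistr_l _ _ _ _ _ (kleene_proto_dioid K) x y z) as D.
rewrite H in D; exact D.
Qed.

(** * The algebra of tests *)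

(** Locality with [one_s] as left factor. *)
Lemma antidom_dom {K : ap_bi_kleene_algebra} (x : K) :
  antidom (dom x) = antidom x.
Proof. rewrite <- (mul1x (dom x)), antidom_mul_dom, mul1x; reflexivity. Qed.

Lemma dom_antidom {K : ap_bi_kleene_algebra} (x : K) :
  dom (antidom x) = antidom x.
Proof. exact (antidom_dom x). Qed.

Lemma dom_dom {K : ap_bi_kleene_algebra} (x : K) : dom (dom x) = dom x.
Proof. apply dom_antidom. Qed.

Lemma dom_mul_dom {K : ap_bi_kleene_algebra} (x y : K) :
  dom (x ⋅ dom y) = dom (x ⋅ y).
Proof. unfold dom at 1; rewrite antidom_mul_dom; reflexivity. Qed.

Lemma antidom_le_one {K : ap_bi_kleene_algebra} (x : K) : antidom x <= one_s.
Proof. rewrite <- (add_antidom_dom x); apply le_add_l. Qed.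

Lemma antidom_one {K : ap_bi_kleene_algebra} : antidom (@one_s K) = zero.
Proof. rewrite <- (mulx1 (antidom one_s)); apply mul_antidom_self. Qed.

Lemma antidom_zero {K : ap_bi_kleene_algebra} : antidom (@zero K) = one_s.
Proof.
rewrite <- (add_antidom_dom (@one_s K)); unfold dom; rewrite antidom_one.
rewrite addC, addx0; reflexivity.
Qed.

Lemma mul_antidom_zero {K : ap_bi_kleene_algebra} (x : K) :
  antidom x ⋅ zero = zero.
Proof.
apply le_zero_eq; rewrite <- (mul1x zero) at 2.
apply mul_mono_l, antidom_le_one.
Qed.

Lemma mul_dom_self {K : ap_bi_kleene_algebra} (x : K) : dom x ⋅ x = x.
Proof.
rewrite <- (mul1x x) at 3; rewrite <- (add_antidom_dom x).
rewrite mulDx, mul_antidom_self, addC, addx0; reflexivity.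
Qed.

Lemma mul_antidom_antidom_self {K : ap_bi_kleene_algebra} (x : K) :
  antidom x ⋅ antidom x = antidom x.
Proof. pose proof (mul_dom_self (antidom x)) as H; rewrite dom_antidom in H; exact H. Qed.

(** By locality [y] can be replaced by [dom y]; splitting [one_s] as [antidom y + dom y] then leaves
    [antidom x ⋅ antidom y]. This is the main tool for proving inequalities between tests. *)
Lemma antidom_le_of_mul_eq0 {K : ap_bi_kleene_algebra} (x y : K) :
  antidom x ⋅ y = zero -> antidom x <= antidom y.
Proof.
intros H.
assert (E : antidom x ⋅ dom y = zero).
(* An element whose domain is [zero] is itself [zero], being the product of its domain with
   itself. *)
{ rewrite <- (mul_dom_self (antidom x ⋅ dom y)), dom_mul_dom, H; unfold dom at 1.
  rewrite antidom_zero, antidom_one; apply mul0x. }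
rewrite <- (mulx1 (antidom x)), <- (add_antidom_dom y).
rewrite mul_antidom_add, E, addx0.
rewrite <- (mul1x (antidom y)) at 2; apply mul_mono_l, antidom_le_one.
Qed.

Lemma antidom_anti {K : ap_bi_kleene_algebra} (x y : K) :
  x <= y -> antidom y <= antidom x.
Proof.
intros H; apply antidom_le_of_mul_eq0, le_zero_eq.
rewrite <- (mul_antidom_self y); apply mul_mono_r, H.
Qed.

Lemma dom_mono {K : ap_bi_kleene_algebra} (x y : K) :
  x <= y -> dom x <= dom y.
Proof. intros H; apply antidom_anti, antidom_anti, H. Qed.

Lemma mul_antidom_le_l {K : ap_bi_kleene_algebra} (x y : K) :
  x ⋅ antidom y <= x.
Proof. rewrite <- (mulx1 x) at 2; apply mul_mono_r, antidom_le_one. Qed.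

Lemma mul_antidom_le_r {K : ap_bi_kleene_algebra} (x y : K) :
  antidom x ⋅ y <= y.
Proof. rewrite <- (mul1x y) at 2; apply mul_mono_l, antidom_le_one. Qed.

(** Tests are idempotent, so the lower bound can be doubled and each copy enlarged separately. *)
Lemma mul_antidom_glb {K : ap_bi_kleene_algebra} (x y z : K) :
  antidom z <= x -> antidom z <= y -> antidom z <= x ⋅ y.
Proof.
intros H1 H2; rewrite <- mul_antidom_antidom_self.
apply le_trans with (x ⋅ antidom z); [apply mul_mono_l | apply mul_mono_r]; auto.
Qed.

Lemma dom_mul_antidom {K : ap_bi_kleene_algebra} (x y : K) :
  dom (antidom x ⋅ antidom y) = antidom x ⋅ antidom y.
Proof.
apply le_antisym.
- apply mul_antidom_glb.
  + rewrite <- (dom_antidom x) at 2; apply dom_mono, mul_antidom_le_l.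
  + rewrite <- (dom_antidom y) at 2; apply dom_mono, mul_antidom_le_r.
(* Any [z] below [one_s] satisfies [z = dom z ⋅ z <= dom z]. *)
- rewrite <- (mul_dom_self (antidom x ⋅ antidom y)) at 1.
  rewrite <- (mulx1 (dom _)) at 2; apply mul_mono_r.
  apply le_trans with (antidom x); [apply mul_antidom_le_l | apply antidom_le_one].
Qed.

Lemma mul_antidom_comm {K : ap_bi_kleene_algebra} (x y : K) :
  antidom x ⋅ antidom y = antidom y ⋅ antidom x.
Proof.
(* Writing the left side as a domain gives it the antidomain form that [mul_antidom_glb] expects. *)
apply le_antisym; rewrite <- dom_mul_antidom; apply mul_antidom_glb;
  fold (dom (antidom x ⋅ antidom y)) (dom (antidom y ⋅ antidom x));
  rewrite dom_mul_antidom; auto using mul_antidom_le_l, mul_antidom_le_r.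
Qed.

Lemma antidom_add {K : ap_bi_kleene_algebra} (x y : K) :
  antidom (x + y) = antidom x ⋅ antidom y.
Proof.
apply le_antisym.
- apply mul_antidom_glb; apply antidom_anti; [apply le_add_l | apply le_add_r].
(* The product is a test, so it distributes over [x + y]; commuting its factors lets it annihilate
   each summand. *)
- rewrite <- dom_mul_antidom; apply antidom_le_of_mul_eq0.
  rewrite mul_antidom_add; fold (dom (antidom x ⋅ antidom y)).
  rewrite dom_mul_antidom; rewrite (mul_antidom_comm x y) at 1.
  rewrite <- !mulA_l, !mul_antidom_self, !mul_antidom_zero; apply addx0.
Qed.

Lemma antidom_mul_antidom {K : ap_bi_kleene_algebra} (x y : K) :
  antidom (antidom x ⋅ antidom y) = dom x + dom y.
Proof. rewrite <- par_antidom; apply antidom_par. Qed.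

Lemma dom_add {K : ap_bi_kleene_algebra} (x y : K) :
  dom (x + y) = dom x + dom y.
Proof. unfold dom at 1; rewrite antidom_add; apply antidom_mul_antidom. Qed.

Lemma dom_par {K : ap_bi_kleene_algebra} (x y : K) :
  dom (x ∥ y) = dom x ⋅ dom y.
Proof. unfold dom at 1; rewrite antidom_par; apply antidom_add. Qed.

Lemma dom_antidom_mul_le {K : ap_bi_kleene_algebra} (x y : K) :
  dom (antidom x ⋅ y) <= antidom x.
Proof.
rewrite <- (dom_antidom x) at 2; apply antidom_anti, antidom_le_of_mul_eq0.
rewrite mulA_l, mul_antidom_self; apply mul0x.
Qed.

(** * Diamonds *)

Lemma dia_add {K : ap_bi_kleene_algebra} (x y p : K) :
  ⟨x + y⟩ p = ⟨x⟩ p + ⟨y⟩ p.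
Proof. unfold dia; rewrite mulDx; apply dom_add. Qed.

(** Locality removes the inner domain; the triple product reassociates because its last factor is a
    test. *)
Lemma dia_mul {K : ap_bi_kleene_algebra} (x y w : K) :
  ⟨x ⋅ y⟩ antidom w = ⟨x⟩ ⟨y⟩ antidom w.
Proof. unfold dia; rewrite dom_mul_dom, mulA_r; reflexivity. Qed.

Lemma dia_par {K : ap_bi_kleene_algebra} (x y w : K) :
  ⟨x ∥ y⟩ antidom w = (⟨x⟩ antidom w) ⋅ (⟨y⟩ antidom w).
Proof. unfold dia; rewrite mul_par_antidom; apply dom_par. Qed.

Lemma dia_mono_l {K : ap_bi_kleene_algebra} (x y p : K) :
  x <= y -> ⟨x⟩ p <= ⟨y⟩ p.
Proof. intros H; apply dom_mono, mul_mono_l, H. Qed.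

Lemma dia_mono_r {K : ap_bi_kleene_algebra} (x p q : K) :
  p <= q -> ⟨x⟩ p <= ⟨x⟩ q.
Proof. intros H; apply dom_mono, mul_mono_r, H. Qed.

Lemma star_unfold_le {K : ap_bi_kleene_algebra} (x : K) :
  one_s + x ⋅ x^∗ <= x^∗.
Proof. apply (star_unfold _ _ _ _ _ _ _ (ap_bi_kleene_ap_kleene K)). Qed.

Lemma dia_star_unfold_le {K : ap_bi_kleene_algebra} (x w : K) :
  antidom w + ⟨x⟩ ⟨x^∗⟩ antidom w <= ⟨x^∗⟩ antidom w.
Proof.
rewrite <- dia_mul; rewrite <- (dom_antidom w) at 1.
(* The summand [antidom w] becomes the diamond of [one_s], so that the left side is a single diamond
   of [one_s + x ⋅ x^∗]. *)
rewrite <- (mul1x (antidom w)) at 1.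
fold (⟨one_s⟩ antidom w); rewrite <- dia_add.
apply dia_mono_l, star_unfold_le.
Qed.

Lemma dia_star_induct {K : ap_bi_kleene_algebra} (x w : K) :
  ⟨x⟩ antidom w <= antidom w -> ⟨x^∗⟩ antidom w <= antidom w.
Proof.
intros H; set (p := antidom w).
apply le_trans with (dom (p ⋅ (x^∗ ⋅ p))); [|apply dom_antidom_mul_le].
apply dom_mono.
apply (star_induct _ _ _ _ _ _ _ (ap_bi_kleene_ap_kleene K)), add_lub.
- fold p; apply le_trans with (p ⋅ p).
  { unfold p; rewrite mul_antidom_antidom_self; apply le_refl. }
  apply mul_mono_r; rewrite <- (mul1x p) at 1; apply mul_mono_l.
  apply le_trans with (2 := star_unfold_le x); apply le_add_l.
(* The hypothesis says that [dom (x ⋅ p)] is below [p], and [dom (x ⋅ p)] preserves [x ⋅ p] from the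
   left. *)
- assert (E : x ⋅ p <= p ⋅ (x ⋅ p)).
  { rewrite <- (mul_dom_self (x ⋅ p)) at 1; apply mul_mono_l, H. }
  (* [E] extracts a test [p] on the left; dropping the inner [p] then leaves [x ⋅ x^∗ ⋅ p], which
     the star absorbs. Unfolding [p] exposes the antidomain that licenses each reassociation. *)
  unfold p at 1; rewrite mulA_m; fold p.
  apply le_trans with (p ⋅ (x ⋅ p) ⋅ (x^∗ ⋅ p)); [apply mul_mono_l, E|].
  unfold p at 1; rewrite <- mulA_l; fold p; apply mul_mono_r.
  unfold p at 1; rewrite <- mulA_m; fold p.
  apply le_trans with (x ⋅ (x^∗ ⋅ p)).
  { apply mul_mono_r, mul_antidom_le_r. }
  unfold p at 1; rewrite mulA_r; apply mul_mono_l.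
  apply le_trans with (2 := star_unfold_le x); apply le_add_r.
Qed.

Lemma dia_star_unfold {K : ap_bi_kleene_algebra} (x w : K) :
  antidom w + ⟨x⟩ ⟨x^∗⟩ antidom w = ⟨x^∗⟩ antidom w.
Proof.
apply le_antisym; [apply dia_star_unfold_le|].
set (q := antidom w + ⟨x⟩ ⟨x^∗⟩ antidom w).
apply le_trans with (⟨x^∗⟩ q); [apply dia_mono_r, le_add_l|].
(* Induction applies only to tests: [q] is a sum of two antidomains, hence the antidomain of a
   parallel composition. *)
assert (E : exists v, q = antidom v).
{ unfold q, dia at 1, dom; rewrite <- antidom_par; eauto. }
assert (H : ⟨x⟩ q <= q).
{ apply le_trans with (⟨x⟩ ⟨x^∗⟩ antidom w); [|apply le_add_r].
  apply dia_mono_r, dia_star_unfold_le. }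
destruct E as [v E]; rewrite E in *; apply dia_star_induct, H.
Qed.

(** * Boxes *)

(** De Morgan duality, used to transfer the star laws from diamonds to boxes. *)
Lemma antidom_dia {K : ap_bi_kleene_algebra} (x p : K) :
  antidom (⟨x⟩ antidom p) = ⟦x⟧ p.
Proof. apply antidom_dom. Qed.

Lemma box_add {K : ap_bi_kleene_algebra} (x y p : K) :
  ⟦x + y⟧ p = (⟦x⟧ p) ⋅ (⟦y⟧ p).
Proof. unfold box; rewrite mulDx; apply antidom_add. Qed.

Lemma box_mul {K : ap_bi_kleene_algebra} (x y p : K) :
  ⟦x ⋅ y⟧ p = ⟦x⟧ ⟦y⟧ p.
Proof.
unfold box at 1 2; rewrite <- mulA_r, <- antidom_mul_dom; reflexivity.
Qed.

Lemma box_par {K : ap_bi_kleene_algebra} (x y p : K) :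
  ⟦x ∥ y⟧ p = ⟦x⟧ p + ⟦y⟧ p.
Proof. unfold box; rewrite mul_par_antidom; apply antidom_par. Qed.

Lemma box_star_unfold {K : ap_bi_kleene_algebra} (x p : K) :
  dom p ⋅ (⟦x⟧ ⟦x^∗⟧ p) = ⟦x^∗⟧ p.
Proof.
(* The diamond unfold law at [antidom p] is negated: the sum becomes a product, and the summand
   [antidom p] becomes [dom p]. *)
rewrite <- (antidom_dia x^∗ p) at 2.
rewrite <- dia_star_unfold, antidom_add, <- dia_mul, antidom_dia, box_mul.
reflexivity.
Qed.

Lemma box_star_induct {K : ap_bi_kleene_algebra} (x p : K) :
  p <= ⟦x⟧ p -> dom p <= ⟦x^∗⟧ p.
Proof.
intros H; rewrite <- antidom_dia; apply antidom_anti, dia_star_induct.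
(* By definition, [antidom (⟦x⟧ p)] is [⟨x⟩ antidom p]. *)
exact (antidom_anti _ _ H).
Qed.

Theorem theorem12p3 (K : ap_bi_kleene_algebra) (x y p q : K)
    (hp : in_dom p) (hq : in_dom q) :
  ((⟨x + y⟩ p = ⟨x⟩ p + ⟨y⟩ p) /\
   (⟨x ⋅ y⟩ p = ⟨x⟩ ⟨y⟩ p) /\
   (⟨p⟩ q = p ⋅ q) /\
   (⟨x ∥ y⟩ p = (⟨x⟩ p) ⋅ (⟨y⟩ p)) /\
   (p + ⟨x⟩ ⟨x^∗⟩ p = ⟨x^∗⟩ p) /\
   (⟨x⟩ p <= p -> ⟨x^∗⟩ p <= p))
  /\
  ((⟦x + y⟧ p = (⟦x⟧ p) ⋅ (⟦y⟧ p)) /\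
   (⟦x ⋅ y⟧ p = ⟦x⟧ ⟦y⟧ p) /\
   (⟦p⟧ q = antidom p + q) /\
   (⟦x ∥ y⟧ p = ⟦x⟧ p + ⟦y⟧ p) /\
   (p ⋅ (⟦x⟧ ⟦x^∗⟧ p) = ⟦x^∗⟧ p) /\
   (p <= ⟦x⟧ p -> p <= ⟦x^∗⟧ p)).
Proof.
destruct hp as [v hv], hq as [w hw].
assert (hp : dom p = p) by (rewrite hv; apply dom_dom).
split; repeat apply conj.
- apply dia_add.
- rewrite hv; apply dia_mul.
- rewrite hv, hw; apply dom_mul_antidom.
- rewrite hv; apply dia_par.
- rewrite hv; apply dia_star_unfold.
- rewrite hv; apply dia_star_induct.
- apply box_add.
- apply box_mul.
(* With [p = dom v] and [q = dom w], this is the De Morgan law for a product of tests. *)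
- rewrite hv, hw; unfold box; rewrite antidom_dom; unfold dom at 1.
  rewrite antidom_mul_antidom, dom_antidom, antidom_dom; reflexivity.
- apply box_par.
- rewrite <- hp at 1; apply box_star_unfold.
- intros H; rewrite <- hp at 1; apply box_star_induct, H.
Qed.
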